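(* Consider the freeway system described in the context, with $n\ge3$ and equilibrium point $x^*=(x_1^*,\dots,x_n^* )$. Suppose that $0<f_i(s)<a_{i+1}$ for all $s\in(0,a_i]$ and $i=1,\dots,n-1$. Suppose that constants $k_n,k_{n-1},\dots,k_2$ and $c_1,c_2,\dots,c_n$ have been found (in this order) by the following algorithm, i.e. that they satisfy the conditions of the following steps: Step 1: $k_n\in[x_n^*,a_n)$ satisfies $\min_{k_n\le s\le a_n}\left(f_n(s)-\min(a_n-s,F)\right)>0$ and $\max_{0\le s\le k_n}\left(s-f_n(s)+\min(a_n-s,F)\right)\le k_n$, where $F:=\max_{s\in[0,a_{n-1}]}f_{n-1}(s)$. Step $n+1-i$, for $i\in\{2,\dots,n-1\}$: $k_i\in[x_i^*,a_i)$ satisfies $\min_{k_i\le s\le a_i}\left(\min(a_{i+1}-k_{i+1},f_i(s))-\min(a_i-s,F)\right)>0$ and $\max_{0\le s\le k_i}\left(s-\min(a_{i+1}-k_{i+1},f_i(s))+\min(a_i-s,F)\right)\le k_i$, where $F:=\max_{s\in[0,a_{i-1}]}f_{i-1}(s)$. Step $n$: $c_1\in[x_1^*,a_1)$ satisfies $\min_{c_1\le s\le a_1}\left(\min(a_2-k_2,f_1(s))-\min(a_1-s,v)\right)>0$ and $\max_{0\le s\le c_1}\left(s-\min(a_2-k_2,f_1(s))+\min(a_1-s,v)\right)\le c_1$. Step $n+i-1$, for $i\in\{2,\dots,n-1\}$: $c_i\in[x_i^*,k_i]$ satisfies $\min_{c_i\le s\le k_i}\left(\min(a_{i+1}-k_{i+1},f_i(s))-\min(a_i-s,F)\right)>0$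 and $\max_{0\le s\le c_i}\left(s-\min(a_{i+1}-k_{i+1},f_i(s))+\min(a_i-s,F)\right)\le c_i$, where $F:=\max_{s\in[0,c_{i-1}]}f_{i-1}(s)$. Step $2n-1$: $c_n\in[x_n^*,k_n]$ satisfies $\min_{c_n\le s\le k_n}\left(f_n(s)-\min(a_n-s,F)\right)>0$ and $\max_{0\le s\le c_n}\left(s-f_n(s)+\min(a_n-s,F)\right)\le c_n$, where $F:=\max_{s\in[0,c_{n-1}]}f_{n-1}(s)$. Furthermore, assume that there exist constants $\lambda_i\in[0,1)$ ($i=1,\dots,n$) such that $$\left|s-x_i^*-\min(a_{i+1}-c_{i+1},f_i(s))+\min(a_i-s,v)\right|\le\lambda_i|s-x_i^*|,\quad s\in[0,c_i],\ i=1,\dots,n-1,$$ $$\left|s-x_i^*-\min(a_{i+1},f_i(s))+\min(a_i-s,v)\right|\le\lambda_i|s-x_i^*|,\quad s\in[0,c_i],\ i=1,\dots,n-1,$$ $$\left|s-x_n^*-f_n(s)+\min(a_n-s,v)\right|\le\lambda_n|s-x_n^*|,\quad s\in[0,c_n].$$ Moreover, assume that there exists a constant $L\ge0$ such that $|f_i(x)-v|\le L|x-x_i^*|$ for all $x\in[0,a_i]$ and $i=1,\dots,n$. Then the equilibrium point $x^*\in[0,a_1]\times\dots\times[0,a_n]$ is Globally Exponentially Stable (GES) for the system.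
   Context: System. $a_i>0$ ($i=1,\dots,n$) and $v>0$ are constants and $f_i:[0,a_i]\to\mathbb{R}_+=[0,+\infty)$ are continuous functions with $f_i(s)\le s$ for all $s\in[0,a_i]$. The system, on the state space $S=[0,a_1]\times\dots\times[0,a_n]$, is $$x_1^+=x_1-\min(a_2-x_2,f_1(x_1))+\min(a_1-x_1,v),$$ $$x_i^+=x_i-\min(a_{i+1}-x_{i+1},f_i(x_i))+\min(a_i-x_i,f_{i-1}(x_{i-1})),\quad i=2,\dots,n-1,$$ $$x_n^+=x_n-f_n(x_n)+\min(a_n-x_n,f_{n-1}(x_{n-1})).$$ It is assumed that there is a vector $x^*=(x_1^*,\dots,x_n^* )\in S$ with $f_i(x_i^* )=v$ and $x_i^*+v<a_i$ for $i=1,\dots,n$ (so $x^*$ is an equilibrium point). GES: there exist constants $M,\sigma>0$ such that for every $x_0\in S$ the solution $x(t)$ with $x(0)=x_0$ satisfies $|x(t)-x^*|\le M\exp(-\sigma t)|x_0-x^*|$ for all integers $t\ge0$, where $|\cdot|$ is the Euclidean norm. *)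

(* Defs.v *)
From HB Require Import structures.
From mathcomp Require Import all_boot all_order all_algebra.
From mathcomp Require Import all_classical all_reals all_analysis.

Set Implicit Arguments.
Unset Strict Implicit.
Unset Printing Implicit Defensive.

Import Order.TTheory GRing.Theory Num.Theory.
Import numFieldNormedType.Exports.

Local Open Scope classical_set_scope.
Local Open Scope ring_scope.

Section Extrema.
Variable R : realType.
Implicit Types (lo hi : R) (g : R -> R).

(* max_{lo <= s <= hi} g s and min_{lo <= s <= hi} g s.  They are attained when
   lo <= hi and g is continuous on [lo, hi]: see max_onP and min_onP. *)
Definition max_on lo hi g : R := sup (g @` `[lo, hi]).
Definition min_on lo hi g : R := inf (g @` `[lo, hi]).

Lemma max_onP lo hi g : lo <= hi -> {within `[lo, hi], continuous g} ->
  exists2 s, s \in `[lo, hi] &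
    g s = max_on lo hi g /\ (forall t, t \in `[lo, hi] -> g t <= max_on lo hi g).
Proof.
move=> lohi cg; have [s sI smax] := EVT_max lohi cg.
suff E : g s = max_on lo hi g by exists s => //; rewrite -E.
have ubs : ubound (g @` `[lo, hi]) (g s) by move=> _ [t tI <-]; exact: smax.
apply/eqP; rewrite eq_le; apply/andP; split.
  by apply: ub_le_sup; [exists (g s) | exists s].
by apply: ge_sup => //; exists (g s), s.
Qed.

Lemma min_onP lo hi g : lo <= hi -> {within `[lo, hi], continuous g} ->
  exists2 s, s \in `[lo, hi] &
    g s = min_on lo hi g /\ (forall t, t \in `[lo, hi] -> min_on lo hi g <= g t).
Proof.
move=> lohi cg; have [s sI smin] := EVT_min lohi cg.
suff E : g s = min_on lo hi g by exists s => //; rewrite -E.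
have lbs : lbound (g @` `[lo, hi]) (g s) by move=> _ [t tI <-]; exact: smin.
apply/eqP; rewrite eq_le; apply/andP; split.
  by apply: lb_le_inf => //; exists (g s), s.
by apply: ge_inf; [exists (g s) | exists s].
Qed.

End Extrema.

Section Stability.
Variables (R : realType) (n : nat).

(* The library norm on row vectors is the sup norm. *)
Definition enorm (x : 'rV[R]_n) : R := Num.sqrt (\sum_i x 0 i ^+ 2).

Definition GES (S : set 'rV[R]_n) (F : 'rV[R]_n -> 'rV[R]_n) (xs : 'rV[R]_n) :=
  exists M sigma : R, [/\ 0 < M, 0 < sigma &
    forall x0, S x0 -> forall t : nat,
      enorm (iter t F x0 - xs) <= M * expR (- sigma * t%:R) * enorm (x0 - xs)].

End Stability.

(* Cells are numbered from 0: the first cell has value 0 and the last one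
   satisfies i.+1 = n.  The neighbours of
   cell i are ordS i and ord_pred i; both are cyclic, but ordS is only meant
   to be used for i.+1 < n and ord_pred only for 0 < i.  Each f i is only
   meaningful on [0, a i]. *)
Section Freeway.
Variables (R : realType) (n : nat).
Variables (a : 'I_n -> R) (v : R) (f : 'I_n -> R -> R).

Definition state_space : set 'rV[R]_n :=
  [set x | forall i, 0 <= x 0 i <= a i].

Definition outflow (x : 'rV[R]_n) (i : 'I_n) : R :=
  if i.+1 == n then f i (x 0 i)
  else Num.min (a (ordS i) - x 0 (ordS i)) (f i (x 0 i)).

Definition inflow (x : 'rV[R]_n) (i : 'I_n) : R :=
  Num.min (a i - x 0 i)
          (if i == 0 :> nat then v else f (ord_pred i) (x 0 (ord_pred i))).

Definition freeway (x : 'rV[R]_n) : 'rV[R]_n :=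
  \row_i (x 0 i - outflow x i + inflow x i).

Definition freeway_data : Prop :=
  [/\ 0 < v, (forall i, 0 < a i),
      (forall i, {within `[0, a i], continuous (f i)}) &
      (forall i s, 0 <= s <= a i -> 0 <= f i s <= s)].

Definition freeway_equilibrium (xs : 'rV[R]_n) : Prop :=
  state_space xs /\ forall i, f i (xs 0 i) = v /\ xs 0 i + v < a i.

(* Over one time step the density s becomes s - out s + inn s: it decreases on
   [b, hi] and [0, b] is mapped below b. *)
Definition trapping (b hi : R) (out inn : R -> R) : Prop :=
  0 < min_on b hi (fun s => out s - inn s) /\
  max_on 0 b (fun s => s - out s + inn s) <= b.

(* The value of k at the first cell is unconstrained and never used.  The clauses
   follow the order in which the algorithm finds the constants. *)
Definition algorithm (xs : 'rV[R]_n) (k c : 'I_n -> R) : Prop :=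
  [/\ (forall i : 'I_n, i.+1 = n ->
        let F := max_on 0 (a (ord_pred i)) (f (ord_pred i)) in
        xs 0 i <= k i < a i /\
        trapping (k i) (a i) (f i) (fun s => Num.min (a i - s) F)),
      (forall i : 'I_n, (0 < i)%N -> (i.+1 < n)%N ->
        let F := max_on 0 (a (ord_pred i)) (f (ord_pred i)) in
        xs 0 i <= k i < a i /\
        trapping (k i) (a i)
          (fun s => Num.min (a (ordS i) - k (ordS i)) (f i s))
          (fun s => Num.min (a i - s) F)),
      (forall i : 'I_n, i = 0%N :> nat ->
        xs 0 i <= c i < a i /\
        trapping (c i) (a i)
          (fun s => Num.min (a (ordS i) - k (ordS i)) (f i s))
          (fun s => Num.min (a i - s) v)),
      (forall i : 'I_n, (0 < i)%N -> (i.+1 < n)%N ->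
        let F := max_on 0 (c (ord_pred i)) (f (ord_pred i)) in
        xs 0 i <= c i <= k i /\
        trapping (c i) (k i)
          (fun s => Num.min (a (ordS i) - k (ordS i)) (f i s))
          (fun s => Num.min (a i - s) F)) &
      (forall i : 'I_n, i.+1 = n ->
        let F := max_on 0 (c (ord_pred i)) (f (ord_pred i)) in
        xs 0 i <= c i <= k i /\
        trapping (c i) (k i) (f i) (fun s => Num.min (a i - s) F))].

End Freeway.

(* Main.v *)
Require Import Defs.
From mathcomp Require Import all_boot all_order all_algebra.
From mathcomp Require Import all_classical all_reals all_analysis.
From mathcomp Require Import ring lra.
Import Order.TTheory GRing.Theory Num.Theory.
Import numFieldNormedType.Exports.
Local Open Scope classical_set_scope.
Local Open Scope ring_scope.

(** Congestion cannot persist, and without congestion the freeway is a cascade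
    of contractions.

    First, every trajectory enters the box [prod_i [0, c i]] within a time that
    does not depend on the initial state, and stays there ([absorbed_c]).  The
    trapping conditions give this one cell at a time ([cell_absorbed]): if the
    outflow of a cell is bounded below by [out] and its inflow above by [inn],
    then its density loses at least [min (out - inn) > 0] per step until it is
    below the threshold, and it never rises above it again.  The bounds come
    from the neighbours.  Knowing that cell [i+1] is below [k (i+1)] bounds the
    outflow of cell [i] from below, so the thresholds [k] are reached one
    after the other from the last cell to the second ([absorbed_k]).  Knowing in addition that cell [i-1] is
    below [c (i-1)] bounds its inflow from above, so the thresholds [c] are
    reached from the first cell to the last.

    Second, inside the box the errors [e i = x i - xs i] satisfy the cascade
    [|e i|+ <= lambda i * |e i| + L * |e (i-1)|] ([freeway_cascade]).  The
    outflow of cell [i] is nonincreasing in the density of cell [i+1], so that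
    replacing this density by its extreme values [0] and [c (i+1)], and the
    demand [f (i-1) (x (i-1))] by [v], encloses the update between the two maps
    assumed to contract; replacing the demand costs at most [L * |e (i-1)|],
    and nothing in the first cell, whose demand is [v].  The coupling is
    one-directional, so for [r] large enough the weighted norm
    [max_i |e i| / r ^ i] contracts.

    During the bounded transient the error grows at most geometrically
    ([freeway_growth]), by the Lipschitz bound at the equilibrium.
    [GES_of_absorbed] combines uniform entrance, bounded growth, and
    contraction in the weighted norm. *)

(** * Minima, maxima and absolute values *)

Section RealLemmas.
Context {R : realType}.

Lemma ler_norm_min (p q p' q' : R) :
  `|Num.min p q - Num.min p' q'| <= `|p - p'| + `|q - q'|.
Proof.
have Hp : p - p' <= `|p - p'| by rewrite ler_norm.
have Hp' : p' - p <= `|p - p'| by rewrite distrC ler_norm.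
have Hq : q - q' <= `|q - q'| by rewrite ler_norm.
have Hq' : q' - q <= `|q - q'| by rewrite distrC ler_norm.
by rewrite ler_norml; case: (leP p q) => ?; case: (leP p' q') => ?; lra.
Qed.

Lemma ler_norm_between {l u y B : R} :
  `|l| <= B -> `|u| <= B -> l <= y <= u -> `|y| <= B.
Proof. by rewrite !ler_norml => /andP[? ?] /andP[? ?] /andP[? ?]; lra. Qed.

(** [inf] takes the value 0 on sets without infimum, so that a positive one is a
    genuine lower bound. *)
Lemma min_on_lb {lo hi : R} {g : R -> R} : 0 < min_on lo hi g ->
  forall s, lo <= s <= hi -> min_on lo hi g <= g s.
Proof.
move=> gm s sI; have [[_ lb]|no] := pselect (has_inf (g @` `[lo, hi])).
  by apply: ge_inf => //; exists s => //=; rewrite in_itv.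
by move: gm; rewrite /min_on inf_out // ltxx.
Qed.

Lemma max_on_ub {lo hi U : R} {g : R -> R} :
  (forall s, lo <= s <= hi -> g s <= U) ->
  forall s, lo <= s <= hi -> g s <= max_on lo hi g.
Proof.
move=> gU s sI; apply: ub_le_sup; last by exists s => //=; rewrite in_itv.
by exists U => _ [t /= tI <-]; apply: gU; rewrite in_itv in tI.
Qed.

End RealLemmas.

(** * Absorption in uniform time *)

Section Absorbed.
Context {R : realType} {T : Type} (S : set T) (F : T -> T).

(** The entrance time is uniform in the initial state: this is what makes the
    transient contribute only a constant factor to the exponential bound. *)
Definition absorbed (D : set T) : Prop :=
  exists N : nat, forall x t, S x -> (N <= t)%N -> D (iter t F x).

Lemma absorbed_all (I : finType) (D : I -> set T) :
  (forall i, absorbed (D i)) -> absorbed [set x | forall i, D i x].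
Proof.
move=> /choice[N HN]; exists (\max_i N i) => x t Sx Nt i.
by apply: HN => //; apply: leq_trans Nt; apply: leq_bigmax.
Qed.

Lemma absorbedI (D D' : set T) :
  absorbed D -> absorbed D' -> absorbed (D `&` D').
Proof.
move=> [N HN] [N' HN']; exists (maxn N N') => x t Sx.
by rewrite geq_max => /andP[? ?]; split; [apply: HN | apply: HN'].
Qed.

(** While [y] exceeds [b] it drops by at least [d] per step, so [(hi - b) / d]
    steps suffice whatever the starting point; once below [b], it stays
    there. *)
Lemma absorbed_le (y : T -> R) (b hi d : R) (D : set T) : 0 < d ->
  absorbed D ->
  (forall x, D x -> y x <= hi) ->
  (forall x, D x -> y x <= b -> y (F x) <= b) ->
  (forall x, D x -> b < y x -> y (F x) <= y x - d) ->
  absorbed [set x | y x <= b].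
Proof.
move=> d0 [N HN] yhi stay drop; pose m := (Num.truncn ((hi - b) / d)).+1.
have hm : hi - b < m%:R * d by rewrite -ltr_pdivrMr //; exact: truncnS_gt.
have descent x j : S x ->
    y (iter (N + j) F x) <= b \/ y (iter (N + j) F x) <= hi - j%:R * d.
  move=> Sx; elim: j => [|j IH].
    by right; rewrite mul0r subr0; apply/yhi/HN => //; rewrite addn0.
  have Dx : D (iter (N + j) F x) by apply: HN; rewrite ?leq_addr.
  rewrite addnS iterS; have [le|gt] := leP (y (iter (N + j) F x)) b.
    by left; exact: stay.
  right; have := drop _ Dx gt; case: IH => [|IH]; first by rewrite leNgt gt.
  by rewrite -natr1 mulrDl mul1r; lra.
exists (N + m)%N => x t Sx Nmt /=.
have E : t = (N + (t - N))%N.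
  by rewrite subnKC // (leq_trans (leq_addr m N)).
rewrite E; have [//|/le_trans] := descent x (t - N)%N Sx; apply.
have : m%:R * d <= (t - N)%:R * d.
  by rewrite ler_pM2r // ler_nat leq_subRL // (leq_trans (leq_addr m N)).
lra.
Qed.

End Absorbed.

(** * Exponential stability from absorption and weighted contraction *)

Section Norms.
Context {R : realType} {n : nat}.

Lemma coord_le_enorm (x : 'rV[R]_n) i : `|x 0 i| <= enorm x.
Proof.
rewrite -sqrtr_sqr; apply: ler_wsqrtr; rewrite (bigD1 i) //= lerDl.
by apply: sumr_ge0 => j _; exact: sqr_ge0.
Qed.

Lemma enorm_le_coord (x : 'rV[R]_n) B : 0 <= B ->
  (forall i, `|x 0 i| <= B) -> enorm x <= n%:R * B.
Proof.
move=> B0 xB; rewrite -[leRHS]ger0_norm ?mulr_ge0 // -sqrtr_sqr.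
apply: ler_wsqrtr; apply: (@le_trans _ _ (\sum_(i < n) B ^+ 2)).
  by apply: ler_sum => i _; rewrite -real_normK ?num_real // lerXn2r ?nnegrE.
rewrite sumr_const card_ord -[B ^+ 2 *+ n]mulr_natl exprMn ler_wpM2r ?sqr_ge0 //.
rewrite -natrX ler_nat.
by have [->//|n0] := posnP n; rewrite -{1}(expn1 n) leq_pexp2l.
Qed.

(** With [N] the uniform entrance time in [D] and [E] the initial error, each
    coordinate is at most [K ^ N * E] up to time [N], and at most
    [r ^ i * rho ^ (t - N) * K ^ N * E] at a later time [t]: the weights [r ^ i]
    cost the factor [r ^ n] and the delay [N] costs [rho ^ (- N)]. *)
Lemma GES_of_absorbed (S D : set 'rV[R]_n) (F : 'rV[R]_n -> 'rV[R]_n)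
    (xs : 'rV[R]_n) (K r rho : R) :
  1 <= K -> 1 <= r -> 0 < rho < 1 ->
  (forall x, S x -> S (F x)) ->
  absorbed S F D ->
  (forall x (E : R), S x -> (forall i, `|x 0 i - xs 0 i| <= E) ->
     forall i, `|F x 0 i - xs 0 i| <= K * E) ->
  (forall x (E : R), S x -> D x -> (forall i, `|x 0 i - xs 0 i| <= r ^+ i * E) ->
     forall i, `|F x 0 i - xs 0 i| <= r ^+ i * (rho * E)) ->
  GES S F xs.
Proof.
move=> K1 r1 /andP[rho0 rho1] invS [N absD] growth decay.
have K0 : 0 < K by lra.
have r0 : 0 < r by lra.
have inS x t : S x -> S (iter t F x) by move=> Sx; elim: t => //= t; exact: invS.
have transient x t i : S x ->
    `|iter t F x 0 i - xs 0 i| <= K ^+ t * enorm (x - xs).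
  move=> Sx; elim: t i => [|t IH] i.
    by rewrite expr0 mul1r; have := coord_le_enorm (x - xs) i; rewrite !mxE.
  by rewrite iterS exprS -mulrA; apply: growth => //; exact: inS.
have tail x j i : S x ->
    `|iter (N + j) F x 0 i - xs 0 i| <=
    r ^+ i * (rho ^+ j * (K ^+ N * enorm (x - xs))).
  move=> Sx; elim: j i => [|j IH] i.
    rewrite addn0 expr0 mul1r; apply: le_trans (transient x N i Sx) _.
    by rewrite ler_peMl ?mulr_ge0 ?exprn_ge0 ?sqrtr_ge0 ?exprn_ege1 // ltW.
  rewrite addnS iterS exprS -[_ * _ * (K ^+ N * _)]mulrA; apply: decay => //.
    exact: inS.
  by apply: absD => //; rewrite leq_addr.
pose C := r ^+ n * K ^+ N / rho ^+ N.
have C0 : 0 < C by rewrite divr_gt0 ?mulr_gt0 ?exprn_gt0.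
have decays x t i : S x ->
    `|iter t F x 0 i - xs 0 i| <= C * rho ^+ t * enorm (x - xs).
  move=> Sx; have [tN|Nt] := leqP t N.
    apply: le_trans (transient x t i Sx) _; rewrite ler_wpM2r ?sqrtr_ge0 //.
    rewrite /C mulrAC ler_pdivlMr ?exprn_gt0 //.
    apply: ler_pM; rewrite ?exprn_ge0 ?(ltW rho0) ?(ltW K0) //; last first.
      by apply: ler_wiXn2l => //; exact: ltW.
    apply: le_trans (ler_weXn2l K1 tN) _.
    by rewrite ler_peMl ?exprn_ge0 ?exprn_ege1 // ltW.
  have E : t = (N + (t - N))%N by rewrite subnKC // ltnW.
  rewrite {1}E; apply: le_trans (tail x (t - N)%N i Sx) _.
  have -> : rho ^+ t = rho ^+ N * rho ^+ (t - N).
    by rewrite -exprD subnKC // ltnW.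
  rewrite /C.
  have -> : r ^+ n * K ^+ N / rho ^+ N * (rho ^+ N * rho ^+ (t - N)) =
      r ^+ n * (rho ^+ (t - N) * K ^+ N).
    by rewrite mulrA divfK ?expf_neq0 ?gt_eqF // -mulrA [_ * K ^+ N]mulrC.
  rewrite !mulrA -[_ * K ^+ N * _]mulrA -!mulrA.
  apply: ler_wpM2r; first by rewrite !mulr_ge0 ?exprn_ge0 ?sqrtr_ge0 // ltW.
  by apply: ler_weXn2l => //; exact/ltnW/ltn_ord.
clearbody C.
(* The factor [n.+1] instead of [n] keeps the constant positive when [n = 0]. *)
exists (n.+1%:R * C), (- ln rho); split.
- by rewrite mulr_gt0.
- by rewrite oppr_gt0 ln_lt0 ?rho0.
move=> x Sx t.
have -> : expR (- - ln rho * t%:R) = rho ^+ t.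
  by rewrite opprK mulrC expRM_natl lnK.
have B0 : 0 <= C * rho ^+ t * enorm (x - xs).
  by rewrite !mulr_ge0 ?exprn_ge0 ?sqrtr_ge0 ?(ltW C0) ?(ltW rho0).
apply: le_trans (enorm_le_coord (iter t F x - xs) _ B0 _) _.
  by move=> i; rewrite !mxE; exact: decays.
by rewrite -!mulrA in B0 *; rewrite ler_wpM2r ?ler_nat.
Qed.

End Norms.

(** * Entrance in the box of the thresholds *)

Section Neighbours.
Context {n : nat}.

Lemma val_ordS (i : 'I_n) : (i.+1 < n)%N -> ordS i = i.+1 :> nat.
Proof. by move=> i1; rewrite /= modn_small. Qed.

Lemma val_ord_pred (i : 'I_n) : (0 < i)%N -> ord_pred i = i.-1 :> nat.
Proof.
case: i => -[//|i] /= i1 _.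
by rewrite modnDr modn_small // ltnW.
Qed.

End Neighbours.

Section Freeway.
Context {R : realType} {n : nat} {a : 'I_n -> R} {v : R} {f : 'I_n -> R -> R}.
Hypothesis (hsys : freeway_data a v f).

Let S : set 'rV[R]_n := state_space a.
Let F : 'rV[R]_n -> 'rV[R]_n := freeway a v f.

Lemma freewayE (x : 'rV[R]_n) (i : 'I_n) :
  F x 0 i = x 0 i - outflow a f x i + inflow a v f x i.
Proof. by rewrite mxE. Qed.

Lemma freeway_state x : S x -> S (F x).
Proof.
case: hsys => v0 a0 _ fs Sx i; rewrite freewayE.
have out : 0 <= outflow a f x i <= x 0 i.
  have /andP[f0 fx] := fs i (x 0 i) (Sx i); rewrite /outflow.
  have /andP[_ xS] := Sx (ordS i).
  by case: ifP => _; rewrite ?f0 // le_min ge_min f0 fx subr_ge0 xS orbT.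
have inn : 0 <= inflow a v f x i <= a i - x 0 i.
  rewrite /inflow ge_min lexx andbT le_min subr_ge0 (andP (Sx i)).2 /=.
  case: ifP => _; first exact: ltW.
  by have /andP[] := fs (ord_pred i) _ (Sx (ord_pred i)).
by move: out inn => /andP[? ?] /andP[? ?]; apply/andP; split; lra.
Qed.

(** One run of a step of the algorithm: [out] and [inn] are the bounds on the
    flows of cell [i] that hold once the trajectory is in [D], and [hi] is the
    bound on its density already known there. *)
Lemma cell_absorbed (i : 'I_n) (b hi : R) (out inn : R -> R)
    (D : set 'rV[R]_n) :
  trapping b hi out inn -> 0 <= b -> b <= a i ->
  (forall s, 0 <= s <= a i -> 0 <= out s) ->
  (forall s, inn s <= a i - s) ->
  absorbed S F D ->
  (forall x, S x -> D x -> [/\ x 0 i <= hi, out (x 0 i) <= outflow a f x i &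
     inflow a v f x i <= inn (x 0 i)]) ->
  absorbed S F [set x | x 0 i <= b].
Proof.
move=> [dpos stay] b0 ba out0 innle absD HD.
have stayE : forall s, 0 <= s <= b -> s - out s + inn s <= b.
  move=> s sb; apply: le_trans stay; move: s sb.
  (* The map is bounded by [a i], so its supremum is an upper bound. *)
  apply: (@max_on_ub _ _ _ (a i)) => s /andP[s0 sb].
  by have := innle s; have := out0 s; rewrite s0 (le_trans sb ba) => /(_ isT); lra.
have dropE := min_on_lb dpos.
apply: (absorbed_le S F (fun x : 'rV_n => x 0 i) b hi _ (S `&` D) dpos).
- case: absD => N absD; exists N => x t Sx Nt; split; last exact: absD.
  by elim: (t) => //= j; exact: freeway_state.
- by move=> x [Sx Dx]; have [] := HD x Sx Dx.
- move=> x [Sx Dx] xb; rewrite freewayE; have [_ Ho Hi] := HD x Sx Dx.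
  by have := stayE (x 0 i); rewrite xb (andP (Sx i)).1 => /(_ isT); lra.
- move=> x [Sx Dx] bx; rewrite freewayE; have [xhi Ho Hi] := HD x Sx Dx.
  by have := dropE (x 0 i); rewrite xhi (ltW bx) => /(_ isT); lra.
Qed.

Lemma inflow_le_max (x : 'rV[R]_n) (i : 'I_n) c : (0 < i)%N -> S x ->
  x 0 (ord_pred i) <= c -> c <= a (ord_pred i) ->
  inflow a v f x i <=
    Num.min (a i - x 0 i) (max_on 0 c (f (ord_pred i))).
Proof.
case: hsys => _ _ _ fs i0 Sx xc ca; rewrite /inflow gtn_eqF //.
rewrite le_min ge_min lexx /= ge_min; apply/orP; right.
apply: (@max_on_ub _ _ _ (a (ord_pred i))); last by rewrite (andP (Sx _)).1.
move=> s /andP[s0 sc]; have sa := le_trans sc ca.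
by have /andP[_ /le_trans->] := fs (ord_pred i) s (introT andP (conj s0 sa)).
Qed.

Lemma outflow_ge (x : 'rV[R]_n) (i : 'I_n) b : (i.+1 < n)%N -> x 0 (ordS i) <= b ->
  Num.min (a (ordS i) - b) (f i (x 0 i)) <= outflow a f x i.
Proof.
move=> i1 xb; rewrite /outflow ltn_eqF //.
by rewrite le_min !ge_min lexx orbT andbT lerD2l lerN2 xb.
Qed.

Section Algorithm.
Context {xs : 'rV[R]_n} {k c : 'I_n -> R}.
Hypotheses (hxs : freeway_equilibrium a v f xs)
  (halg : algorithm a v f xs k c).

Let k_bounds (i : 'I_n) : (0 < i)%N -> 0 <= k i < a i.
Proof.
case: halg => hn hm _ _ _ i0.
have xs0 := (andP (hxs.1 i)).1.
have [i1|ni] := ltnP i.+1 n.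
  by have [/andP[xk ->] _] := hm i i0 i1; rewrite (le_trans xs0 xk).
have En : i.+1 = n by apply/eqP; rewrite eqn_leq ni ltn_ord.
by have [/andP[xk ->] _] := hn i En; rewrite (le_trans xs0 xk).
Qed.

Lemma c_bounds (i : 'I_n) : 0 <= c i < a i.
Proof.
case: halg => _ _ h1 hm hn; have xs0 := (andP (hxs.1 i)).1.
have [i0|i0] := posnP i.
  by have [/andP[xc ->] _] := h1 i i0; rewrite (le_trans xs0 xc).
have /andP[_ ka] := k_bounds i i0.
have [i1|ni] := ltnP i.+1 n.
  have [/andP[xc ck] _] := hm i i0 i1.
  by rewrite (le_trans xs0 xc) (le_lt_trans ck ka).
have En : i.+1 = n by apply/eqP; rewrite eqn_leq ni ltn_ord.
have [/andP[xc ck] _] := hn i En.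
by rewrite (le_trans xs0 xc) (le_lt_trans ck ka).
Qed.

Let out_min_ge0 (i : 'I_n) : (i.+1 < n)%N -> forall s, 0 <= s <= a i ->
  0 <= Num.min (a (ordS i) - k (ordS i)) (f i s).
Proof.
case: hsys => _ _ _ fs i1 s sa; rewrite le_min (andP (fs i s sa)).1 andbT.
have /andP[_ /ltW] : 0 <= k (ordS i) < a (ordS i).
  by apply: k_bounds; rewrite val_ordS.
by rewrite subr_ge0.
Qed.

Let min_inn_le (i : 'I_n) (u s : R) : Num.min (a i - s) u <= a i - s.
Proof. by rewrite ge_min lexx. Qed.

(** Downward induction on [i]: the bound on the inflow holds on the whole state
    space, and that on the outflow once cell [i+1] is below [k (i+1)] (in the
    last cell the outflow is [f i] itself). *)
Lemma absorbed_k (i : 'I_n) : (0 < i)%N -> absorbed S F [set x | x 0 i <= k i].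
Proof.
move: {2}(n - i)%N (erefl (n - i)%N) => m.
case: hsys => _ _ _ fs; case: (halg) => hn hm _ _ _.
elim: m i => [|m IH] i.
  by move/eqP; rewrite subn_eq0 leqNgt ltn_ord.
move=> Em i0; have /andP[k0 /ltW ka] := k_bounds i i0.
have [i1|ni] := ltnP i.+1 n.
  have [_ trap] := hm i i0 i1.
  apply: (cell_absorbed _ _ _ _ _ _ trap k0 ka (out_min_ge0 i i1) (min_inn_le i _)
    (IH (ordS i) _ _)); rewrite ?val_ordS // ?subnS ?Em //.
  move=> x Sx xk; split; first exact: (andP (Sx i)).2.
    exact: outflow_ge.
  by apply: inflow_le_max => //; exact: (andP (Sx _)).2.
have En : i.+1 = n by apply/eqP; rewrite eqn_leq ni ltn_ord.
have [_ trap] := hn i En.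
apply: (cell_absorbed _ _ _ _ _ setT trap k0 ka _ (min_inn_le i _)).
- by move=> s sa; have /andP[] := fs i s sa.
- by exists 0%N.
move=> x Sx _; split; first exact: (andP (Sx i)).2.
  by rewrite /outflow En eqxx.
by apply: inflow_le_max => //; exact: (andP (Sx _)).2.
Qed.

(** Upward induction on [i]: the density is already below [k i], which is the
    upper end of the range where it must decrease, and the maximal inflow is now
    taken over the densities of cell [i-1] below [c (i-1)]. *)
Lemma absorbed_c (i : 'I_n) : (1 < n)%N -> absorbed S F [set x | x 0 i <= c i].
Proof.
move=> n1.
move: {2}(nat_of_ord i) (erefl (nat_of_ord i)) => m.
case: hsys => _ _ _ fs; case: (halg) => _ _ h1 hm hn.
elim: m i => [|m IH] i Em; have /andP[c0 /ltW ca] := c_bounds i.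
  have i1 : (i.+1 < n)%N by rewrite Em.
  have [_ trap] := h1 i Em.
  have kS : absorbed S F [set x | x 0 (ordS i) <= k (ordS i)].
    by apply: absorbed_k; rewrite val_ordS.
  apply: (cell_absorbed _ _ _ _ _ _ trap c0 ca (out_min_ge0 i i1) (min_inn_le i _) kS).
  move=> x Sx xk; split; [exact: (andP (Sx i)).2 | exact: outflow_ge |].
  by rewrite /inflow Em.
have i0 : (0 < i)%N by rewrite Em.
have /andP[_ /ltW cpa] := c_bounds (ord_pred i).
have cp : absorbed S F [set x | x 0 (ord_pred i) <= c (ord_pred i)].
  by apply: IH; rewrite val_ord_pred // Em.
have [i1|ni] := ltnP i.+1 n.
  have [_ trap] := hm i i0 i1.
  have kS : absorbed S F [set x | x 0 (ordS i) <= k (ordS i)].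
    by apply: absorbed_k; rewrite val_ordS.
  apply: (cell_absorbed _ _ _ _ _ _ trap c0 ca (out_min_ge0 i i1) (min_inn_le i _)
    (absorbedI _ _ _ _ (absorbedI _ _ _ _ (absorbed_k i i0) kS) cp)).
  move=> x Sx [[xk xkS] xc]; split; [exact: xk | exact: outflow_ge |].
  exact: inflow_le_max.
have En : i.+1 = n by apply/eqP; rewrite eqn_leq ni ltn_ord.
have [_ trap] := hn i En.
apply: (cell_absorbed _ _ _ _ _ _ trap c0 ca _ (min_inn_le i _)
    (absorbedI _ _ _ _ (absorbed_k i i0) cp)).
  by move=> s sa; have /andP[] := fs i s sa.
move=> x Sx [xk xc]; split; [exact: xk | by rewrite /outflow En eqxx |].
exact: inflow_le_max.
Qed.

End Algorithm.

(** * One-step error estimates *)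

Section Estimates.
Context {xs : 'rV[R]_n} {L : R}.
Hypotheses (hxs : freeway_equilibrium a v f xs) (hL : 0 <= L).
Hypothesis hLip : forall (i : 'I_n) (s : R), 0 <= s <= a i ->
  `|f i s - v| <= L * `|s - xs 0 i|.

(** At the equilibrium all flows equal [v], since [xs i + v < a i] makes the gap
    terms inactive; each flow then varies by at most [(1 + L) * E], the [1]
    coming from the gap and the [L] from the flow function. *)
Lemma freeway_growth x (E : R) : S x -> (forall i, `|x 0 i - xs 0 i| <= E) ->
  forall i, `|F x 0 i - xs 0 i| <= (3 + 2 * L) * E.
Proof.
move=> Sx xE i; case: hsys => v0 _ _ _.
have E0 : 0 <= E := le_trans (normr_ge0 _) (xE i).
have LE0 : 0 <= L * E by exact: mulr_ge0.
have fE j : `|f j (x 0 j) - v| <= L * E.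
  by apply: le_trans (hLip j _ (Sx j)) _; rewrite ler_wpM2l.
have gapE j : `|a j - x 0 j - (a j - xs 0 j)| <= E.
  by rewrite opprB addrC subrKA distrC.
have minv j : Num.min (a j - xs 0 j) v = v.
  by apply: min_r; have := (hxs.2 j).2; lra.
have out : `|outflow a f x i - v| <= E + L * E.
  rewrite /outflow; case: ifP => _; first by have := fE i; lra.
  rewrite -(minv (ordS i)); apply: le_trans (ler_norm_min _ _ _ _) _.
  exact: lerD.
have inn : `|inflow a v f x i - v| <= E + L * E.
  rewrite /inflow -{2}(minv i); apply: le_trans (ler_norm_min _ _ _ _) _.
  apply: lerD => //; case: ifP => _; last exact: fE.
  by rewrite subrr normr0.
have := xE i; rewrite freewayE; move: out inn; rewrite !ler_norml.
by move=> /andP[? ?] /andP[? ?] /andP[? ?]; apply/andP; split; lra.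
Qed.

Context {c lambda : 'I_n -> R}.
Hypothesis hcontr_c : forall i : 'I_n, (i.+1 < n)%N -> forall s : R, 0 <= s <= c i ->
  `|s - xs 0 i - Num.min (a (ordS i) - c (ordS i)) (f i s)
    + Num.min (a i - s) v| <= lambda i * `|s - xs 0 i|.
Hypothesis hcontr_a : forall i : 'I_n, (i.+1 < n)%N -> forall s : R, 0 <= s <= c i ->
  `|s - xs 0 i - Num.min (a (ordS i)) (f i s)
    + Num.min (a i - s) v| <= lambda i * `|s - xs 0 i|.
Hypothesis hcontr_n : forall i : 'I_n, i.+1 = n -> forall s : R, 0 <= s <= c i ->
  `|s - xs 0 i - f i s + Num.min (a i - s) v| <= lambda i * `|s - xs 0 i|.

(** With demand [v] at the entrance of cell [i], the update is monotone in the
    density of cell [i+1], hence lies between the two contracting maps (in the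
    last cell it is the contracting map itself); the actual demand adds an error
    of at most [L * |e (i-1)|]. *)
Lemma freeway_cascade x : S x -> (forall i, x 0 i <= c i) -> forall i,
  `|F x 0 i - xs 0 i| <= lambda i * `|x 0 i - xs 0 i| +
    (if i == 0 :> nat then 0 else L * `|x 0 (ord_pred i) - xs 0 (ord_pred i)|).
Proof.
move=> Sx xc i; have x0 j : 0 <= x 0 j := (andP (Sx j)).1.
have xci : 0 <= x 0 i <= c i by rewrite x0 xc.
have own : `|x 0 i - xs 0 i - outflow a f x i + Num.min (a i - x 0 i) v| <=
    lambda i * `|x 0 i - xs 0 i|.
  rewrite /outflow; case: eqP => [En|/eqP ni]; first exact: hcontr_n.
  have i1 : (i.+1 < n)%N by rewrite ltn_neqAle ni ltn_ord.
  apply: ler_norm_between (hcontr_a i i1 _ xci) (hcontr_c i i1 _ xci) _.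
  rewrite !lerD2r !lerD2l !lerN2 !le_min !ge_min !lexx !orbT !andbT.
  by rewrite lerD2l lerN2 xc gerBl x0.
have coupling : `|inflow a v f x i - Num.min (a i - x 0 i) v| <=
    (if i == 0 :> nat then 0 else L * `|x 0 (ord_pred i) - xs 0 (ord_pred i)|).
  rewrite /inflow; apply: le_trans (ler_norm_min _ _ _ _) _.
  by rewrite subrr normr0 add0r; case: ifP => _; [rewrite subrr normr0|exact: hLip].
rewrite freewayE; apply: le_trans (lerD own coupling).
apply: le_trans (ler_normD _ _); rewrite le_eqVlt; apply/orP; left.
by apply/eqP; congr (`|_|); lra.
Qed.

End Estimates.
End Freeway.

Theorem corollary4p4 (R : realType) (n : nat) (a : 'I_n -> R) (v : R)
  (f : 'I_n -> R -> R) (xs : 'rV[R]_n) (k c lambda : 'I_n -> R) (L : R)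
  (hn : (3 <= n)%N)
  (hsys : freeway_data a v f)
  (hxs : freeway_equilibrium a v f xs)
  (hf : forall i : 'I_n, (i.+1 < n)%N ->
     forall s, 0 < s <= a i -> 0 < f i s < a (ordS i))
  (halg : algorithm a v f xs k c)
  (hlambda : forall i, 0 <= lambda i < 1)
  (hcontr_c : forall i : 'I_n, (i.+1 < n)%N -> forall s, 0 <= s <= c i ->
     `|s - xs 0 i - Num.min (a (ordS i) - c (ordS i)) (f i s)
       + Num.min (a i - s) v| <= lambda i * `|s - xs 0 i|)
  (hcontr_a : forall i : 'I_n, (i.+1 < n)%N -> forall s, 0 <= s <= c i ->
     `|s - xs 0 i - Num.min (a (ordS i)) (f i s)
       + Num.min (a i - s) v| <= lambda i * `|s - xs 0 i|)
  (hcontr_n : forall i : 'I_n, i.+1 = n -> forall s, 0 <= s <= c i ->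
     `|s - xs 0 i - f i s + Num.min (a i - s) v| <= lambda i * `|s - xs 0 i|)
  (hL : 0 <= L)
  (hLip : forall (i : 'I_n) s, 0 <= s <= a i ->
     `|f i s - v| <= L * `|s - xs 0 i|) :
  GES (state_space a) (freeway a v f) xs.
Proof.
pose Lam := \big[Num.max/0]_(i < n) lambda i.
have Lam01 : 0 <= Lam < 1.
  rewrite /Lam; elim/big_ind: _ => [|p q /andP[p0 p1] /andP[q0 q1]|i _ //].
    by rewrite lexx ltr01.
  by rewrite le_max p0 gt_max p1 q1.
have [Lam0 Lam1] := andP Lam01.
have lamLam i : lambda i <= Lam by exact: le_bigmax.
(* [r] is large enough for the coupling to cost only half the gap [1 - Lam]. *)
pose r := 1 + 2 * L / (1 - Lam).
have r1 : 1 <= r by rewrite lerDl divr_ge0 ?mulr_ge0 // subr_ge0 ltW.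
have Lr : L <= (1 - Lam) / 2 * r.
  have -> : (1 - Lam) / 2 * r = (1 - Lam) / 2 + L by rewrite /r; field; lra.
  by lra.
pose rho := (1 + Lam) / 2.
apply: (@GES_of_absorbed _ _ _ [set x | forall i, x 0 i <= c i] _ _
  (3 + 2 * L) r rho) => //.
- by lra.
- by rewrite /rho; apply/andP; split; lra.
- exact: freeway_state hsys.
- apply: absorbed_all => i; apply: (absorbed_c hsys hxs halg).
  exact: leq_trans hn.
- exact: freeway_growth.
move=> x E Sx xc xE i.
have E0 : 0 <= E.
  by have := le_trans (normr_ge0 _) (xE i); rewrite pmulr_rge0 // exprn_gt0; lra.
have rE0 j : 0 <= r ^+ j * E by rewrite mulr_ge0 ?exprn_ge0; lra.
apply: le_trans (freeway_cascade hLip hcontr_c hcontr_a hcontr_n x Sx xc i) _.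
have own : lambda i * `|x 0 i - xs 0 i| <= Lam * (r ^+ i * E).
  by apply: ler_pM => //; have /andP[] := hlambda i.
have prev : (if i == 0 :> nat then 0
    else L * `|x 0 (ord_pred i) - xs 0 (ord_pred i)|) <=
    (1 - Lam) / 2 * (r ^+ i * E).
  have [i0|i0] := posnP i; first by rewrite mulr_ge0 //; lra.
  apply: le_trans (ler_wpM2l hL (xE _)) _.
  rewrite val_ord_pred // -{2}(prednK i0) exprS -[r * _ * E]mulrA [leRHS]mulrA.
  exact: ler_wpM2r.
apply: le_trans (lerD own prev) _; rewrite -mulrDl [leRHS]mulrCA.
by rewrite (_ : Lam + (1 - Lam) / 2 = rho) // /rho; lra.
Qed.
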